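(* For every integer $n\geq 1$, let $C_{\mathrm{NBW}}(n)$ be the maximum of $C_{\mathrm{NBW}}(\mathcal{A})$ over all NBWs $\mathcal{A}$ with $n$ states. Then $C_{\mathrm{NBW}}(n)=C_{\mathrm{NBW}}(\mathcal{A})$ for some full NBW $\mathcal{A}$ with $n$ states.
   Context: An NBW (nondeterministic Büchi word automaton) is $\mathcal{A}=(\Sigma,S,I,\Delta,F)$ with finite alphabet $\Sigma$, finite state set $S$, initial states $I\subseteq S$, transition relation $\Delta\subseteq S\times\Sigma\times S$ and final states $F\subseteq S$. A run over an $\omega$-word $\alpha=\alpha(0)\alpha(1)\cdots\in\Sigma^\omega$ is an infinite sequence $\rho(0)\rho(1)\cdots$ of states with $\rho(0)\in I$ and $\langle\rho(i),\alpha(i),\rho(i+1)\rangle\in\Delta$ for all $i$; it is successful if some state of $F$ occurs infinitely often in it. $\mathcal{L}(\mathcal{A})$ is the set of $\omega$-words having a successful run. $C_{\mathrm{NBW}}(\mathcal{A})$ is the minimum number of states of an NBW over $\Sigma$ accepting $\Sigma^\omega\setminus\mathcal{L}(\mathcal{A})$. A full NBW is one of the form $(\Sigma,S,I,\Delta,F)$ with $S$ finite, $I,F\subseteq S$ arbitrary, $\Sigma=\mathcal{P}(S\times S)$, and $\langle p,a,q\rangle\in\Delta$ iff $\langle p,q\rangle\in a$. *)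

(* Defs.v *)
From mathcomp Require Import all_boot.

Set Implicit Arguments.
Unset Strict Implicit.
Unset Printing Implicit Defensive.

Record nbw (Sigma : finType) := NBW {
  state : finType;
  init : {set state};
  trans : {set state * Sigma * state};
  final : {set state}
}.

Definition nb_states (Sigma : finType) (A : nbw Sigma) : nat := #|state A|.

Definition oword (Sigma : finType) := nat -> Sigma.

Definition is_run (Sigma : finType) (A : nbw Sigma)
    (alpha : oword Sigma) (rho : nat -> state A) : Prop :=
  rho 0 \in init A /\ forall i, (rho i, alpha i, rho i.+1) \in trans A.

Definition occurs_infinitely_often (S : finType) (q : S) (rho : nat -> S) : Prop :=
  forall i, exists2 j, i <= j & rho j = q.

Definition successful (Sigma : finType) (A : nbw Sigma) (rho : nat -> state A) : Prop :=
  exists2 q, q \in final A & occurs_infinitely_often q rho.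

Definition lang (Sigma : finType) (A : nbw Sigma) (alpha : oword Sigma) : Prop :=
  exists2 rho : nat -> state A, is_run alpha rho & successful rho.

Definition complements (Sigma : finType) (B A : nbw Sigma) : Prop :=
  forall alpha, lang B alpha <-> ~ lang A alpha.

(* The minimum over complementing automata is expressed as a relation, so that
   [is_C_NBW A k] asserts in particular that a complementing automaton exists. *)
Definition is_C_NBW (Sigma : finType) (A : nbw Sigma) (k : nat) : Prop :=
  (exists2 B : nbw Sigma, complements B A & nb_states B = k) /\
  (forall B : nbw Sigma, complements B A -> k <= nb_states B).

(* The maximum ranges over all finite alphabets; the second conjunct includes
   that C_NBW(A) is defined for every A with n states. *)
Definition is_C_NBW_max (n m : nat) : Prop :=
  (exists (Sigma : finType) (A : nbw Sigma), nb_states A = n /\ is_C_NBW A m) /\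
  (forall (Sigma : finType) (A : nbw Sigma), nb_states A = n ->
     exists2 k, is_C_NBW A k & k <= m).

Definition full_nbw (S : finType) (I F : {set S}) : nbw {set S * S} :=
  @NBW {set S * S} S I
    [set t : S * {set S * S} * S | (t.1.1, t.2) \in t.1.2] F.

(* Main.v *)
(* Mapping each letter [a] of an automaton with [n] states to the relation
   [{(p, q) | (p, a, q) is a transition}] exhibits its language as the preimage
   of that of a full automaton with the same states, and preimages commute with
   complementation without adding states. There are finitely many full automata
   on n given states, so one of them attains the maximum. That complementing
   automata exist at all is Buechi's theorem, proved by his Ramsey argument:
   every word splits into blocks with profiles [x, e, e, e, ...], the pair
   [(x, e)] decides acceptance, and an automaton can guess such a splitting. *)
Require Import Defs.
From mathcomp Require Import all_boot.
From mathcomp Require Import boolp.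

Set Implicit Arguments.
Unset Strict Implicit.
Unset Printing Implicit Defensive.

(** * Infinite occurrence in finite sets *)

Lemma uniform_bound (T : finType) (P : T -> nat -> Prop) :
  (forall x, exists b, forall j, b <= j -> P x j) ->
  exists b, forall x j, b <= j -> P x j.
Proof.
move=> /fin_all_exists [f fP]; exists (\max_x f x) => x j le_j.
by apply: fP; apply: leq_trans le_j; apply: leq_bigmax.
Qed.

Lemma not_infinitely_often (P : nat -> Prop) :
  ~ (forall b, exists2 j, b <= j & P j) -> exists b, forall j, b <= j -> ~ P j.
Proof.
move=> nP; apply: contrapT => nb; apply: nP => b; apply: contrapT => nj.
by apply: nb; exists b => j le_j Pj; apply: nj; exists j.
Qed.

Lemma infinite_pigeonhole (T : finType) (rho : nat -> T) (P : nat -> Prop) :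
  (forall b, exists2 j, b <= j & P j) ->
  exists q, forall b, exists2 j, b <= j & P j /\ rho j = q.
Proof.
move=> infP; apply: contrapT => nq.
have [|b bP] := @uniform_bound T (fun q j => ~ (P j /\ rho j = q)).
  by move=> q; apply: not_infinitely_often => h; apply: nq; exists q.
by have [j le_j Pj] := infP b; apply: (bP (rho j) j le_j).
Qed.

Lemma successfulP (Sigma : finType) (A : nbw Sigma) (rho : nat -> state A) :
  successful rho <-> forall b, exists2 j, b <= j & rho j \in final A.
Proof.
split=> [[q qF qinf] b|]; first by have [j le_j rj] := qinf b; exists j; rewrite ?rj.
move=> /(infinite_pigeonhole rho) [q qP]; exists q.
  by have [j _ [jF <-]] := qP 0.
by move=> b; have [j le_j [_ rj]] := qP b; exists j.
Qed.

(** * Ramsey's theorem for right-congruent colourings *)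

Section Ramsey.

Variables (T : finType) (c : nat -> nat -> T).
(** Here [c i K] stands for the profile of the segment from [i] up to [K], which is updated letter
    by letter at its right end. *)
Hypothesis c_cong : forall i j K, i <= K -> j <= K ->
  c i K = c j K -> c i K.+1 = c j K.+1.

Lemma colour_eq_later i j K K' : i <= K -> j <= K -> K <= K' ->
  c i K = c j K -> c i K' = c j K'.
Proof.
move=> iK jK /subnK <-; elim: (K' - K) => [|d IH] // /IH {}IH.
by rewrite addSn; apply: c_cong => //; apply: leq_trans (leq_addl _ _).
Qed.

(* Otherwise one builds arbitrarily many positions whose colours eventually
   stay pairwise distinct, more than there are colours. *)
Lemma infinitely_many_merge :
  exists i, forall b, exists2 j, b <= j &
    exists K, [/\ i <= K, j <= K & c i K = c j K].
Proof.
apply: contrapT => none.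
pose M i j := exists K, [/\ i <= K, j <= K & c i K = c j K].
have far i : exists b, forall j, b <= j -> ~ M i j.
  by apply: not_infinitely_often => h; apply: none; exists i.
have many k : exists s N, size s = k /\
    forall K, N <= K -> all (leq^~ K) s && uniq [seq c i K | i <- s].
  elim: k => [|k [s [N [sk sP]]]]; first by exists [::], 0.
  have [b bP] := @uniform_bound 'I_(size s)
    (fun i j => ~ M (nth 0 s i) j) (fun i => far (nth 0 s i)).
  (* Past [b] the new position merges with no member of [s]; past [N] the members of [s] have
     distinct colours. *)
  exists (maxn b N :: s), (maxn b N); split=> [|K leK]; first by rewrite /= sk.
  have /andP [sK uK] := sP K (leq_trans (leq_maxr _ _) leK).
  rewrite /= leK sK uK /= andbT; apply/mapP => -[i i_s eq_c].
  have lt_i : index i s < size s by rewrite index_mem.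
  apply: (bP (Ordinal lt_i) (maxn b N) (leq_maxl _ _)).
  by exists K; rewrite /= nth_index //; split=> //; apply: (allP sK).
have [s [N [sT sP]]] := many #|T|.+1.
have /andP [_ /card_uniqP] := sP N (leqnn N).
by rewrite size_map sT => eqT; have := max_card (mem [seq c i N | i <- s]);
   rewrite eqT ltnn.
Qed.

(** Fix an [i] with which infinitely many [j] merge; infinitely many of these share the colour
    [e = c i j]. Once such a [j] has merged with [i], [c j j' = c i j' = e] for every later such
    [j'], so each next cut is taken beyond the merging point. *)
Lemma additive_ramsey : exists e (f : nat -> nat),
  [/\ 0 < f 0, forall k, f k < f k.+1 & forall k, c (f k) (f k.+1) = e].
Proof.
have [i iP] := infinitely_many_merge.
have [e eP] := infinite_pigeonhole (c i) iP.
pose good j := (exists K, [/\ i <= K, j <= K & c i K = c j K]) /\ c i j = e.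
have next j : exists j', good j -> [/\ j < j', good j' & c j j' = e].
  have [gj|] := pselect (good j); last by exists 0.
  have [[K [iK jK eqK]] _] := gj.
  have [j' le_j' gj'] := eP K.+1; exists j' => _; split=> //.
    exact: leq_ltn_trans le_j'.
  by rewrite -(colour_eq_later iK jK (ltnW le_j') eqK); case: gj'.
have [g gP] := choice next.
(* The bound 1 keeps the first cut off 0, so that the block before it is nonempty. *)
have [j0 j0_gt0 good0] := eP 1.
have good_iter k : good (iter k g j0) by elim: k => //= k /gP [].
by exists e, (fun k => iter k g j0); split=> // k; have [] := gP _ (good_iter k).
Qed.

End Ramsey.

(** * Cutting the time line into blocks *)

Section Blocks.

Variable i : nat -> nat.
Hypotheses (i0 : i 0 = 0) (i_lt : forall k, i k < i k.+1).

Fixpoint block (t : nat) : nat :=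
  if t is t'.+1 then
    if t == i (block t').+1 then (block t').+1 else block t'
  else 0.

Lemma block_bounds t : i (block t) <= t < i (block t).+1.
Proof.
elim: t => [|t /andP [le_t t_lt]] /=; first by have := i_lt 0; rewrite i0.
case: eqP => [->|/eqP ne]; first by rewrite leqnn i_lt.
by rewrite (leq_trans le_t) //= ltn_neqAle ne.
Qed.

Lemma cut_ltn_mono : {mono i : k l / k < l}.
Proof. exact: leqW_mono (leq_mono (homo_ltn ltn_trans i_lt)). Qed.

Lemma block_uniq t k : i k <= t < i k.+1 -> block t = k.
Proof.
move=> /andP [kt tk]; have /andP [bt tb] := block_bounds t.
have : block t < k.+1 by rewrite -cut_ltn_mono (leq_ltn_trans bt).
have : k < (block t).+1 by rewrite -cut_ltn_mono (leq_ltn_trans kt).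
by rewrite !ltnS => kb bk; apply/eqP; rewrite eqn_leq bk.
Qed.

Lemma cut_ge k : k <= i k.
Proof. by elim: k => // k IH; apply: leq_ltn_trans (i_lt k). Qed.

Lemma block_cut k : block (i k) = k.
Proof. by apply: block_uniq; rewrite leqnn i_lt. Qed.

End Blocks.

(** * Complementation *)

Section Profiles.

Variables (Sigma : finType) (A : nbw Sigma).
Implicit Types (alpha beta : oword Sigma) (b : bool).

Definition profile : finType := {set state A * state A * bool}.

Definition profile_id : profile := [set t | (t.1.1 == t.1.2) && ~~ t.2].

Definition profile_step (m : profile) (a : Sigma) : profile :=
  [set t | [exists q, [exists b, [&& (t.1.1, q, b) \in m,
     (q, a, t.1.2) \in trans A & t.2 == b || (t.1.2 \in final A)]]]].

(** Leaving out the start and keeping the end makes the ranges of consecutive blocks disjoint. *)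
Definition visits (r : nat -> state A) s k : bool :=
  has (fun t => r t.+1 \in final A) (iota s k).

Lemma visitsS r s k : visits r s k.+1 = visits r s k || (r (s + k).+1 \in final A).
Proof. by rewrite /visits -(addn1 k) iotaD has_cat /= orbF. Qed.

(* Here [(p, q, b)] records a path from [p] to [q] reading the [k] letters of
   [alpha] from position [s] on; [b] tells whether it meets a final state,
   the starting point excluded. *)
Fixpoint prof alpha (s k : nat) : profile :=
  if k is k'.+1 then profile_step (prof alpha s k') (alpha (s + k'))
  else profile_id.

Lemma profP alpha s k p q b : reflect
  (exists r : nat -> state A, [/\ r s = p, r (s + k) = q,
     forall t, s <= t < s + k -> (r t, alpha t, r t.+1) \in trans A
     & b = visits r s k])
  ((p, q, b) \in prof alpha s k).
Proof.
elim: k q b => [|k IH] q b.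
  rewrite inE /= addn0; apply: (iffP andP) => [[/eqP -> /negPf ->]|].
    by exists (fun=> q); split=> // t /andP [/leq_ltn_trans h /h]; rewrite ltnn.
  by case=> r [-> -> _ ->].
rewrite /= inE /=; apply: (iffP existsP) => [[q' /existsP [b' /and3P []]]|].
  move=> /IH [r [rs rk rt ->]] q't /eqP ->.
  exists (fun t => if t <= s + k then r t else q).
  rewrite leq_addr rs addnS ltnn; split=> // [t /andP [st]|].
    rewrite ltnS => tk; rewrite tk; case: ltnP => [lt_tk|le_kt].
      by apply: rt; rewrite st.
    by have -> : t = s + k; [apply/eqP; rewrite eqn_leq tk | rewrite rk].
  rewrite visitsS ltnn; congr (_ || _).
  by apply: eq_in_has => t; rewrite mem_iota => /andP [_ ->].
case=> r [rs rk rt ->]; exists (r (s + k)); apply/existsP.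
exists (visits r s k); apply/and3P; split.
- apply/IH; exists r; split=> // t /andP [st tk]; apply: rt.
  by rewrite st addnS ltnS ltnW.
- by rewrite -rk addnS; apply: rt; rewrite leq_addr addnS leqnn.
- by rewrite visitsS -rk addnS.
Qed.

Definition cuts alpha (i : nat -> nat) (x e : profile) : Prop :=
  [/\ i 0 = 0, forall k, i k < i k.+1 &
      forall k, prof alpha (i k) (i k.+1 - i k) = if k is 0 then x else e].

(** Corresponding blocks have equal profiles, so each piece of an accepting run on [alpha] can be
    replaced by a path on [beta] with the same endpoints and the same answer about final states. *)
Lemma lang_transfer alpha beta i j x e :
  cuts alpha i x e -> cuts beta j x e -> lang A alpha -> lang A beta.
Proof.
move=> [i0 i_lt ip] [j0 j_lt jp] [rho [rho0 rhoT] /successfulP rhoF].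
have path k : exists r : nat -> state A,
    [/\ r (j k) = rho (i k), r (j k.+1) = rho (i k.+1),
     forall t, j k <= t < j k.+1 -> (r t, beta t, r t.+1) \in trans A
     & visits rho (i k) (i k.+1 - i k) =
       visits r (j k) (j k.+1 - j k)].
  have : (rho (i k), rho (i k.+1),
     visits rho (i k) (i k.+1 - i k))
     \in prof beta (j k) (j k.+1 - j k).
    rewrite jp -ip; apply/profP; exists rho.
    by rewrite (subnKC (ltnW (i_lt k))).
  by move=> /profP; rewrite (subnKC (ltnW (j_lt k))).
have [r rP] := choice path.
pose rho' t := r (block j t) t.
(* The closed right end matters: at a cut the paths of both adjacent blocks agree and can be
   glued. *)
have rhoE k t : j k <= t <= j k.+1 -> rho' t = r k t.
  move=> /andP [kt]; rewrite leq_eqVlt => /predU1P [->|tk].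
    by rewrite /rho' block_cut //; case: (rP k) => _ -> _ _; case: (rP k.+1).
  by rewrite /rho' (block_uniq j0 j_lt (k := k)) ?kt.
exists rho'; first split.
- by case: (rP 0); rewrite i0 j0 => r0 _ _ _; rewrite (rhoE 0) ?j0 ?r0.
- move=> t; have /andP [bt tb] := block_bounds j0 j_lt t.
  rewrite !(rhoE (block j t)) ?bt ?tb ?(ltnW tb) ?(leqW bt) //.
  by case: (rP (block j t)) => _ _ rt _; apply: rt; rewrite bt.
- apply/successfulP => b.
  (* A final state at [t.+1] is credited to the block of [t], because [visits] skips the start of a
     block; [i b <= t] puts that block at index [b] or later. *)
  have [[|t] le_t tF] := rhoF (i b).+1; first by [].
  have /andP [bt tb] := block_bounds i0 i_lt t; set k := block i t in bt tb.
  have bk : b <= k.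
    by rewrite -(ltnS b) -(cut_ltn_mono i_lt); apply: leq_ltn_trans tb.
  case: (rP k) => _ _ _ hE.
  have : visits rho (i k) (i k.+1 - i k).
    by apply/hasP; exists t; rewrite // mem_iota (subnKC (ltnW (i_lt k))) bt.
  rewrite hE => /hasP [u]; rewrite mem_iota (subnKC (ltnW (j_lt k))) => /andP [ku uk] uF.
  exists u.+1; last by rewrite (rhoE k) // uk (leqW ku).
  by apply: leqW; apply: leq_trans ku; apply: leq_trans (cut_ge j_lt k).
Qed.

(** Ramsey's theorem, with each segment coloured by its profile; the cut 0 is put in front. *)
Lemma cuts_exist alpha : exists i x e, cuts alpha i x e.
Proof.
have cong s t K : s <= K -> t <= K ->
    prof alpha s (K - s) = prof alpha t (K - t) ->
    prof alpha s (K.+1 - s) = prof alpha t (K.+1 - t).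
  by move=> sK tK; rewrite !subSn //= !subnKC // => ->.
have [e [f [f0 f_lt fe]]] := additive_ramsey cong.
exists (fun k => if k is k'.+1 then f k' else 0), (prof alpha 0 (f 0)), e.
by split=> // -[|k] //; rewrite subn0.
Qed.

(** By [lang_transfer], one rejected word cut in this way makes the pair rejecting. *)
Definition rejecting (x e : profile) : Prop :=
  forall alpha i, cuts alpha i x e -> ~ lang A alpha.

(** * Büchi's complementing automaton *)

Definition compl_state : finType := (option profile * profile * bool)%type.

(* The first component is the guessed repeated profile [e] ([None] inside the
   first block), the second the profile of the current block read so far, and
   the flag marks the beginning of a block other than the first. *)
Definition compl_trans (s : compl_state) (a : Sigma) (s' : compl_state) : bool :=
  let m := profile_step s.1.2 a in
  (s' == (s.1.1, m, false)) ||
  (if s.1.1 is Some e then (m == e) && (s' == (Some e, profile_id, true))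
   else [exists e, `[< rejecting m e >] && (s' == (Some e, profile_id, true))]).

Definition compl_nbw : nbw Sigma :=
  @NBW Sigma compl_state [set (None, profile_id, false)]
    [set t | compl_trans t.1.1 t.1.2 t.2] [set s | s.2].

(** The run follows the Ramsey cuts of [alpha], raising the flag at every cut but 0. *)
Lemma compl_nbw_complete alpha : ~ lang A alpha -> lang compl_nbw alpha.
Proof.
move=> nA; have [i [x [e ixe]]] := cuts_exist alpha.
have rej : rejecting x e by move=> beta j jxe /(lang_transfer jxe ixe).
case: ixe => i0 i_lt ip.
pose rho t : compl_state := let k := block i t in
  (if k is 0 then None else Some e, prof alpha (i k) (t - i k), (0 < k) && (t == i k)).
exists rho; first split.
- by rewrite /rho /= inE.
- move=> t; have /andP [bt tb] := block_bounds i0 i_lt t.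
  have stepE : profile_step (prof alpha (i (block i t)) (t - i (block i t))) (alpha t)
      = prof alpha (i (block i t)) (t.+1 - i (block i t)).
    by rewrite subSn //= subnKC.
  rewrite inE /compl_trans /= stepE.
  case: (altP (t.+1 =P i (block i t).+1)) => [eqt|net].
    have bE : block i t.+1 = (block i t).+1 by rewrite eqt block_cut.
    apply/orP; right; rewrite /rho bE eqt subnn eqxx /=.
    case: (block i t) => [|k]; last by rewrite (ip k.+1) !eqxx.
    by rewrite (ip 0); apply/existsP; exists e; rewrite eqxx andbT; apply/asboolP.
  have bE : block i t.+1 = block i t by rewrite /= (negPf net).
  by rewrite /rho bE gtn_eqF ?ltnS // andbF eqxx.
- apply/successfulP => b; exists (i b.+1).
    exact: leq_trans (cut_ge i_lt b.+1).
  by rewrite inE /rho block_cut //= eqxx.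
Qed.

(** The flagged times of a successful run cut [alpha] into blocks whose profiles the transitions
    have checked against a rejecting pair. *)
Lemma compl_nbw_sound alpha : lang compl_nbw alpha -> ~ lang A alpha.
Proof.
case=> rho [rho0 rhoT] /successfulP rhoF.
have flagP t : exists t', (t < t') && (rho t').2.
  by have [t' lt] := rhoF t.+1; rewrite inE => h; exists t'; rewrite lt.
(* From 0 on, each cut is the next flagged time. *)
pose i k := iter k (fun t => ex_minn (flagP t)) 0.
have iP k : [/\ i k < i k.+1, (rho (i k.+1)).2
    & forall t, i k < t < i k.+1 -> ~~ (rho t).2].
  rewrite /i /=; case: ex_minnP => t /andP [lt ft] tmin; split=> // u /andP [ku ut].
  by apply/negP => fu; have := tmin u; rewrite ku fu leqNgt ut => /(_ isT).
have i_lt k : i k < i k.+1 by case: (iP k).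
have stepT t : compl_trans (rho t) (alpha t) (rho t.+1).
  by have := rhoT t; rewrite inE.
(* Without a flag at the target, only the first alternative of [compl_trans] applies; in [cross] the
   flag forces the second. *)
have within k : (rho (i k)).1.2 = profile_id -> forall d, i k + d < i k.+1 ->
    (rho (i k + d)).1 = ((rho (i k)).1.1, prof alpha (i k) d).
  move=> start; elim=> [|d IH] lt_d; first by rewrite addn0 /= -start; case: (rho (i k)).1.
  have {}IH : (rho (i k + d)).1 = ((rho (i k)).1.1, prof alpha (i k) d).
    by apply: IH; apply: ltn_trans lt_d; rewrite addnS.
  have nf : ~~ (rho (i k + d).+1).2.
    have [_ _ h] := iP k; rewrite -addnS; apply: h.
    by rewrite lt_d addnS ltnS leq_addr.
  have := stepT (i k + d); rewrite /compl_trans IH /= => /orP [/eqP E|].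
    by rewrite addnS E.
  case: (rho (i k)).1.1 => [e /andP [_ /eqP E]|/existsP [e /andP [_ /eqP E]]];
  by rewrite E in nf.
have cross k : (rho (i k)).1.2 = profile_id ->
  exists2 e, rho (i k.+1) = (Some e, profile_id, true) &
   if (rho (i k)).1.1 is Some e' then e = e' /\ prof alpha (i k) (i k.+1 - i k) = e
   else rejecting (prof alpha (i k) (i k.+1 - i k)) e.
  move=> start; have [lt_k fk _] := iP k.
  have [d dE] : exists d, i k.+1 = (i k + d).+1.
    by exists (i k.+1 - (i k).+1); rewrite -addSn subnKC.
  have := stepT (i k + d); rewrite -dE /compl_trans within //; last by rewrite dE.
  have -> : i k.+1 - i k = d.+1 by rewrite dE -addnS addKn.
  rewrite /= => /orP [/eqP E|]; first by rewrite E in fk.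
  case: (rho (i k)).1.1 => [e /andP [/eqP mE /eqP E]|/existsP [e /andP [/asboolP rej /eqP E]]];
    by exists e.
have rho0E : rho (i 0) = (None, profile_id, false) by apply/eqP; have := rho0; rewrite inE.
have [|e rho1E] := cross 0; first by rewrite rho0E.
rewrite rho0E /= => rej; apply: (rej alpha i).
have rhoE k : rho (i k.+1) = (Some e, profile_id, true).
  elim: k => // k IH; have [|e' E] := cross k.+1; first by rewrite IH.
  by rewrite IH /= => -[<- _].
split=> // -[|k] //.
have [|e' _] := cross k.+1; first by rewrite rhoE.
by rewrite rhoE /= => -[-> ->].
Qed.

Lemma complement_exists : exists B : nbw Sigma, complements B A.
Proof.
exists compl_nbw => alpha.
by split; [apply: compl_nbw_sound | apply: compl_nbw_complete].
Qed.

End Profiles.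

Lemma C_NBW_exists (Sigma : finType) (A : nbw Sigma) : exists k, is_C_NBW A k.
Proof.
pose P k := `[< exists2 B : nbw Sigma, complements B A & nb_states B = k >].
have exP : exists k, P k.
  by have [B BA] := complement_exists A; exists (nb_states B); apply/asboolP; exists B.
exists (ex_minn exP); case: ex_minnP => k /asboolP kP kmin; split=> // B BA.
by apply: kmin; apply/asboolP; exists B.
Qed.

(** * Reduction to full automata *)

Definition preim_nbw (Sigma Gamma : finType) (h : Sigma -> Gamma) (B : nbw Gamma)
    : nbw Sigma :=
  @NBW Sigma (state B) (init B) [set t | (t.1.1, h t.1.2, t.2) \in trans B] (final B).

Lemma lang_preim (Sigma Gamma : finType) (h : Sigma -> Gamma) (B : nbw Gamma) alpha :
  lang (preim_nbw h B) alpha <-> lang B (h \o alpha).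
Proof.
split=> -[rho [rho0 rhoT] rhoF]; exists rho => //; split=> // t;
by have := rhoT t; rewrite inE.
Qed.

(** States are renamed into an ordinal so that all full automata to be compared live on one fixed
    set. *)
Lemma embed_in_full (Sigma : finType) (A : nbw Sigma) :
  exists (I F : {set 'I_(nb_states A)}) h,
    forall alpha : oword Sigma, lang A alpha <-> lang (full_nbw I F) (h \o alpha).
Proof.
pose g : 'I_(nb_states A) -> state A := @enum_val _ (mem (state A)).
pose f : state A -> 'I_(nb_states A) := @enum_rank (state A).
have fK : cancel f g by apply: enum_rankK.
exists [set s | g s \in init A], [set s | g s \in final A].
exists (fun a => [set t | (g t.1, a, g t.2) \in trans A]) => alpha.
split=> -[rho [rho0 rhoT] /successfulP rhoF].
- exists (f \o rho); first split.
  + by rewrite inE /= fK.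
  + by move=> t; rewrite !inE /= !fK.
  + by apply/successfulP => b; have [j bj jF] := rhoF b; exists j; rewrite // inE /= fK.
- exists (g \o rho); first split.
  + by move: rho0; rewrite inE.
  + by move=> t; have := rhoT t; rewrite !inE.
  + by apply/successfulP => b; have [j bj] := rhoF b; rewrite inE; exists j.
Qed.

Lemma C_NBW_preim_le (Sigma Gamma : finType) (h : Sigma -> Gamma) (A : nbw Sigma)
    (A' : nbw Gamma) k k' :
  (forall alpha, lang A alpha <-> lang A' (h \o alpha)) ->
  is_C_NBW A k -> is_C_NBW A' k' -> k <= k'.
Proof.
move=> AA' [_ kmin] [[B BA' <-] _]; apply: (kmin (preim_nbw h B)) => alpha.
by rewrite lang_preim AA'.
Qed.

Theorem theorem3p5 (n : nat) (n_ge1 : 1 <= n) :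
  exists2 m : nat, is_C_NBW_max n m &
    exists (S : finType) (I F : {set S}),
      nb_states (full_nbw I F) = n /\ is_C_NBW (full_nbw I F) m.
Proof.
have [C CP] := fin_all_exists
  (fun IF : {set 'I_n} * {set 'I_n} => C_NBW_exists (full_nbw IF.1 IF.2)).
(* A maximum over the finitely many pairs [(I, F)]; the empty pair only shows that there is one. *)
have [[I F] _ IFmax] := @arg_maxnP _ (set0, set0) xpredT C isT.
have nn : nb_states (full_nbw I F) = n by apply: card_ord.
exists (C (I, F)); last by exists 'I_n, I, F; split=> //; apply: (CP (I, F)).
split=> [|Sigma A An].
  by exists {set 'I_n * 'I_n}, (full_nbw I F); split=> //; apply: (CP (I, F)).
have [I' [F' [h AE]]] : exists (I F : {set 'I_n}) h,
    forall alpha : oword Sigma, lang A alpha <-> lang (full_nbw I F) (h \o alpha).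
  by rewrite -An; apply: embed_in_full.
have [k kP] := C_NBW_exists A; exists k => //.
exact: leq_trans (C_NBW_preim_le AE kP (CP (I', F'))) (IFmax (I', F') isT).
Qed.
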